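(* Let $G=\mathrm{SL}_n(\mathbb C)$ and let $(u,v),(u',v')\in S_n\times S_n$ satisfy $$(u,v)<(u',v'),\qquad \ell(u',v')=\ell(u,v)+1,$$ where $<$ is the product Bruhat order. Then $$G^{u,v}\cap\overline{\mathbb D(G^{u',v'})}\subseteq\mathbb D_{\mathrm{ext}}^{(u,v)\subset(u',v')},$$ where the closure is taken in $G$.
   Context: $G=\mathrm{SL}_n(\mathbb C)$; $B$ (resp. $B^-$) is the subgroup of upper (resp. lower) triangular matrices, $H=B\cap B^-$, $W=S_n$ with simple reflections $s_i=(i,i+1)$ and Coxeter length $\ell$; $\ell(u,v)=\ell(u)+\ell(v)$. The product Bruhat order is $(u,v)\le(u',v')\iff u\le u'$ and $v\le v'$ in Bruhat order. For $u,v\in S_n$, $G^{u,v}=B\dot uB\cap B^-\dot vB^-$, where $\dot w\in N_G(H)$ represents $w$. Put $x_i(t)=I+tE_{i,i+1}$ and $x_{\bar i}(t)=I+tE_{i+1,i}$ for $1\le i\le n-1$. $R(u,v)$ is the set of words $\mathbf i=(i_1,\dots,i_m)$, $m=\ell(u)+\ell(v)$, in the alphabet $\{\bar1,\dots,\overline{n-1},1,\dots,n-1\}$ whose barred subword is a reduced word of $u$ (bars removed) and whose unbarred subword is a reduced word of $v$. Put $T_{\mathbf i}=\{h\,x_{i_1}(t_1)\cdots x_{i_m}(t_m): h\in H,\ t_k\in\mathbb C^*\}\subset G^{u,v}$. The reduced-word deep locus is $\mathbb D(G^{u,v})=G^{u,v}\setminus\bigcup_{\mathbf i\in R(u,v)}T_{\mathbf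 i}$. A factorization torus $T_{\mathbf j}$, $\mathbf j\in R(u,v)$, of the lower cell is extendable if $\mathbf j$ can be obtained by deleting one letter from some word $\mathbf i\in R(u',v')$. $\mathbb D_{\mathrm{ext}}^{(u,v)\subset(u',v')}$ is the complement in $G^{u,v}$ of the union of all extendable tori $T_{\mathbf j}$. *)

(* Defs.v *)
From HB Require Import structures.
From mathcomp Require Import all_boot all_order all_algebra all_fingroup.
From mathcomp Require Import classical_sets reals.
From mathcomp Require Import mpoly.

Set Implicit Arguments.
Unset Strict Implicit.
Unset Printing Implicit Defensive.

Import GRing.Theory.

Local Open Scope classical_set_scope.
Local Open Scope ring_scope.

(* The simple reflections of 'S_n are indexed from 0 by i : 'I_n.-1;
   the index i stands for the pair of consecutive positions (i, i.+1). *)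
Definition pos_lo n (i : 'I_n.-1) : 'I_n := widen_ord (leq_pred n) i.

Definition pos_hi n (i : 'I_n.-1) : 'I_n :=
  Ordinal (etrans (esym (ltn_predRL i n)) (ltn_ord i)).

Definition simple_refl n (i : 'I_n.-1) : 'S_n := tperm (pos_lo i) (pos_hi i).

(* The product in 'S_n composes from left to right. It is the product for
   which perm_mx is multiplicative (perm_mxM), so that sending w to the set of
   its representatives (see represents) is a group isomorphism from 'S_n onto
   N_G(H) / H. *)
Definition word_perm n (s : seq 'I_n.-1) : 'S_n :=
  (\prod_(i <- s) simple_refl i)%g.

Lemma word_perm_cat n (s t : seq 'I_n.-1) :
  word_perm (s ++ t) = (word_perm s * word_perm t)%g.
Proof. by rewrite /word_perm big_cat. Qed.

Lemma tperm_word n (i j : 'I_n) : (i < j)%N ->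
  exists s : seq 'I_n.-1, word_perm s = tperm i j.
Proof.
case: j => j; elim: j => [//|j IHj] lt_j_n /=.
have lt_j_n' : (j < n)%N by apply: ltnW.
have lt_j_p : (j < n.-1)%N by rewrite ltn_predRL.
pose k : 'I_n.-1 := Ordinal lt_j_p.
have lo_k : pos_lo k = Ordinal lt_j_n' by apply: val_inj.
have hi_k : pos_hi k = Ordinal lt_j_n by apply: val_inj.
rewrite ltnS leq_eqVlt => /orP[/eqP def_i | lt_i_j].
  exists [:: k]; rewrite /word_perm big_seq1 /simple_refl lo_k hi_k.
  by congr (tperm _ _); apply: val_inj.
have [s def_s] := IHj lt_j_n' lt_i_j.
exists ([:: k] ++ s ++ [:: k]).
rewrite !word_perm_cat def_s {1 2}/word_perm big_seq1 /simple_refl lo_k hi_k.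
set t := tperm (Ordinal lt_j_n') _.
have def_t : (t * (tperm i (Ordinal lt_j_n') * t) =
              tperm i (Ordinal lt_j_n') ^ t)%g.
  by rewrite conjgE tpermV.
rewrite def_t tpermJ tpermL tpermD // -val_eqE /=.
  by rewrite gtn_eqF.
by rewrite gtn_eqF // ltnS ltnW.
Qed.

Lemma word_perm_exists n (w : 'S_n) :
  exists k, [exists s : k.-tuple 'I_n.-1, word_perm s == w].
Proof.
suff [s <-] : exists s : seq 'I_n.-1, word_perm s = w.
  by exists (size s); apply/existsP; exists (in_tuple s).
have [ts -> _] := prod_tpermP w.
elim: ts => [|[i j] ts [s def_s]].
  by exists [::]; rewrite /word_perm !big_nil.
rewrite big_cons -def_s /=.
have [lt_ij | lt_ji | eq_ij] := ltngtP i j.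
- by have [t <-] := tperm_word lt_ij; exists (t ++ s); rewrite word_perm_cat.
- have [t def_t] := tperm_word lt_ji.
  by exists (t ++ s); rewrite word_perm_cat def_t tpermC.
- by exists s; rewrite (val_inj eq_ij) tperm1 mul1g.
Qed.

Definition cox_length n (w : 'S_n) : nat := ex_minn (word_perm_exists w).

Definition reduced_word n (s : seq 'I_n.-1) (w : 'S_n) : bool :=
  (word_perm s == w) && (size s == cox_length w).

Definition bruhat_step n : rel 'S_n := fun x y =>
  [exists i : 'I_n, exists j : 'I_n, y == (x * tperm i j)%g]
  && (cox_length x < cox_length y)%N.

Definition bruhat_le n : rel 'S_n := connect (@bruhat_step n).

Definition cox_length2 n (p : 'S_n * 'S_n) : nat :=
  (cox_length p.1 + cox_length p.2)%N.

Definition bruhat2_le n : rel ('S_n * 'S_n) := fun p q =>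
  bruhat_le p.1 q.1 && bruhat_le p.2 q.2.

Definition bruhat2_lt n : rel ('S_n * 'S_n) := fun p q =>
  (p != q) && bruhat2_le p q.

Section DoubleBruhatCells.

Variables (K : fieldType) (n : nat).
Implicit Types (g : 'M[K]_n) (u v w : 'S_n).

Definition SL : set 'M[K]_n := [set g | \det g = 1].

(* is_trig_mx means lower triangular *)
Definition Bplus : set 'M[K]_n := SL `&` [set g | is_trig_mx g^T].
Definition Bminus : set 'M[K]_n := SL `&` [set g | is_trig_mx g].
Definition torusH : set 'M[K]_n := Bplus `&` Bminus.

(* The elements of N_G(H) representing w. The matrix perm_mx w need not
   be one of them, since its determinant is the sign of w. *)
Definition represents w : set 'M[K]_n :=
  SL `&` [set g | exists d : 'rV[K]_n, g = diag_mx d *m perm_mx w].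

Definition bruhat_cell (P : set 'M[K]_n) w : set 'M[K]_n :=
  [set g | exists b, exists c, exists wd,
    [/\ P b, P c, represents w wd & g = b *m wd *m c]].

Definition double_cell (p : 'S_n * 'S_n) : set 'M[K]_n :=
  bruhat_cell Bplus p.1 `&` bruhat_cell Bminus p.2.

(* A letter is a barred index (inl i) or an unbarred index (inr i). *)
Definition letter : Type := ('I_n.-1 + 'I_n.-1)%type.

Definition barred (s : seq letter) : seq 'I_n.-1 :=
  pmap (fun a => if a is inl i then Some i else None) s.

Definition unbarred (s : seq letter) : seq 'I_n.-1 :=
  pmap (fun a => if a is inr i then Some i else None) s.

Definition double_reduced (p : 'S_n * 'S_n) : set (seq letter) :=
  [set s | reduced_word (barred s) p.1 && reduced_word (unbarred s) p.2].

Definition letter_mx (a : letter) (t : K) : 'M[K]_n :=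
  match a with
  | inl i => 1%:M + t *: delta_mx (pos_hi i) (pos_lo i)
  | inr i => 1%:M + t *: delta_mx (pos_lo i) (pos_hi i)
  end.

Definition factor_torus (s : seq letter) : set 'M[K]_n :=
  [set g | exists h, exists t : seq K,
    [/\ torusH h, size t = size s, all (fun x => x != 0) t &
        g = h *m \big[mulmx/1%:M]_(a <- zip s t) letter_mx a.1 a.2]].

Definition deep_locus (p : 'S_n * 'S_n) : set 'M[K]_n :=
  double_cell p `\` \bigcup_(s in double_reduced p) factor_torus s.

Definition extendable (q : 'S_n * 'S_n) (s : seq letter) : Prop :=
  exists2 s', double_reduced q s' &
    exists2 k, (k < size s')%N & s = take k s' ++ drop k.+1 s'.

Definition ext_deep_locus (p q : 'S_n * 'S_n) : set 'M[K]_n :=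
  double_cell p `\`
    \bigcup_(s in double_reduced p `&` extendable q) factor_torus s.

(* Zariski closure in SL_n, whose regular functions are the polynomials in
   the n * n matrix entries. *)
Definition SL_closure (A : set 'M[K]_n) : set 'M[K]_n :=
  SL `&` [set g | forall f : {mpoly K[n * n]},
    (forall a, A a -> f.@[fun k => mxvec a 0 k] = 0) ->
    f.@[fun k => mxvec g 0 k] = 0].

End DoubleBruhatCells.

Arguments double_cell K {n} p.
Arguments deep_locus K {n} p.
Arguments ext_deep_locus K {n} p q.

(* Main.v *)
Require Import Defs.
From mathcomp Require Import all_boot all_order all_algebra all_fingroup.
From mathcomp Require Import classical_sets reals complex.
From mathcomp Require Import mpoly ring zify.

Set Implicit Arguments.
Unset Strict Implicit.
Unset Printing Implicit Defensive.

Import GRing.Theory.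

(** Let g lie in the torus of a word s obtained by deleting one letter from a
    double reduced word s' of (u', v'). It is enough to find a polynomial F
    with F g <> 0 such that every x in G^{u',v'} with F x <> 0 lies in the torus
    of s': such an F vanishes on the deep locus of (u', v'), so g is outside its
    closure.

    F is built by removing letters from the right end of s'. Consider a barred
    last letter with index i; the unbarred case follows by the automorphism
    sending x to its inverse transpose, which exchanges B with B^- and barred
    with unbarred letters. If x is in B w' s_i B, then the projective line made
    of the points x x_{\bar i}(-t) and of the point at infinity x s_i meets
    B w' B, and not at t = 0 (cell_peel). Any minor N in the first i columns
    that vanishes on B w' B vanishes at that point. Such a minor satisfies
    N (x x_{\bar i}(-t)) = N x - t D x, where D x is the value of N at x s_i;
    hence as soon as D x <> 0 the point has parameter t = N x / D x
    (cell_peel_minor).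

    To control this near g, N must be chosen so that D g <> 0 too. When the
    last letter of s' is also the last letter of s, let w be the permutation of
    the barred part of the remaining word of g, and take for N the minor that
    does not vanish on B w s_i B. It vanishes at the point of the line of g
    lying in B w B, so N g / D g is the last parameter of g
    (flag_minor_ratio). It vanishes on B w' B as well: otherwise the
    rank counts of w' in the first i columns would dominate those of w s_i.
    This is impossible if w' = w, as w s_i > w. Otherwise w' is w times a
    transposition that raises the length by exactly 1, and domination forces
    w' = w s_i, whereas w' has an ascent at i and w s_i a descent
    (deletes_at_most_one_not_dominated). When the last letter of s' is the
    deleted one, w' = w and the same minor gives N g = 0 and D g <> 0
    (flag_minor_extension), so that g itself is the limit of the shortened
    elements. In both cases removing the letter from x, with parameter
    N x / D x, is a rational map that is regular at g, and induction on s'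
    applies (factor_torus_near). *)

(** * Words with at most one letter deleted *)

Definition deletes_at_most_one (T : Type) (s s' : seq T) : Prop :=
  s = s' \/ exists p a q, s' = p ++ a :: q /\ s = p ++ q.

Lemma deletes_at_most_one_pmap (T U : Type) (f : T -> option U) (s s' : seq T) :
  deletes_at_most_one s s' -> deletes_at_most_one (pmap f s) (pmap f s').
Proof.
move=> [->|[p [a [q [-> ->]]]]]; first by left.
rewrite /deletes_at_most_one !pmap_cat /=; case: (f a) => [b|]; last by left.
by right; exists (pmap f p), b, (pmap f q).
Qed.

(** * Coxeter length as a number of inversions, and rank counts *)

Section Inversions.

Variable n : nat.
Implicit Types (w : 'S_n) (i : 'I_n.-1) (a b : 'I_n) (c : seq 'I_n.-1).

Lemma lo_lt_hi i : pos_lo i < pos_hi i.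
Proof. by rewrite /= ltnSn. Qed.

Lemma lo_neq_hi i : (pos_lo i == pos_hi i) = false.
Proof. by rewrite -val_eqE /= ltn_eqF. Qed.

Lemma simple_reflK w i : (w * simple_refl i * simple_refl i = w)%g.
Proof. by rewrite -mulgA tperm2 mulg1. Qed.

Lemma word_perm_rcons c i :
  word_perm (rcons c i) = (word_perm c * simple_refl i)%g.
Proof. by rewrite /word_perm -cats1 big_cat big_seq1. Qed.

Lemma permV_mul_tperm w a b x : ((w * tperm a b)^-1)%g x = (w^-1)%g (tperm a b x).
Proof. by rewrite invMg permM tpermV. Qed.

(** The inverse is taken because [perm_mx w] has the nonzero entry of its column
    k in row [(w^-1) k]: multiplying [w] on the right by [simple_refl i]
    exchanges two adjacent values of this function. *)
Definition inversions w : {set 'I_n * 'I_n} :=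
  [set pq : 'I_n * 'I_n | (pq.1 < pq.2) && ((w^-1)%g pq.2 < (w^-1)%g pq.1)].

Definition ninv w := #|inversions w|.

Lemma simple_refl_lt i a b :
  a < b -> (a, b) != (pos_lo i, pos_hi i) -> simple_refl i a < simple_refl i b.
Proof.
rewrite xpair_eqE /simple_refl.
by case: tpermP => [->|->|/eqP + /eqP +]; case: tpermP => [->|->|/eqP + /eqP +];
  do ?rewrite -val_eqE; rewrite /=; lia.
Qed.

(** [simple_refl i] preserves the order of every pair of positions except
    (i, i+1), so it carries the inversions of [w] bijectively onto those of
    [w * simple_refl i] other than that pair. *)
Lemma ninv_ascent w i :
  (w^-1)%g (pos_lo i) < (w^-1)%g (pos_hi i) ->
  ninv (w * simple_refl i)%g = (ninv w).+1.
Proof.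
move=> asc; pose s := simple_refl i.
have sK : involutive s by apply: tpermK.
pose f (pq : 'I_n * 'I_n) := (s pq.1, s pq.2).
have fK : involutive f by case=> p q; rewrite /f /= !sK.
have f_im pq (A : {set 'I_n * 'I_n}) : (pq \in f @: A) = (f pq \in A).
  by rewrite -{1}(fK pq) (mem_imset _ _ (inv_inj fK)).
rewrite /ninv; have -> : inversions (w * s)%g = (pos_lo i, pos_hi i) |: f @: inversions w.
  apply/finset.setP => -[p q]; rewrite !inE f_im !inE /= !permV_mul_tperm -/s.
  have [[-> ->]|neq] /= := eqVneq (p, q) (pos_lo i, pos_hi i).
    by rewrite tpermL tpermR ltnSn asc.
  have [lt_pq|le_qp] /= := ltnP p q.
    by rewrite (simple_refl_lt lt_pq neq).
  have [eq_s|neq_s] := eqVneq (s p, s q) (pos_lo i, pos_hi i).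
    move/eqP: eq_s; rewrite xpair_eqE => /andP[/eqP e1 /eqP e2].
    by rewrite e1 e2 [X in _ && X](negPf _) ?andbF // -leqNgt ltnW.
  suff /negPf-> : ~~ (s p < s q) by [].
  apply: contra neq => lt_s; have := simple_refl_lt lt_s neq_s.
  by rewrite -/s !sK ltnNge le_qp.
rewrite cardsU1 (card_imset _ (inv_inj fK)) f_im !inE /= /s /simple_refl tpermL tpermR.
by rewrite ltnNge ltnW ?lo_lt_hi.
Qed.

Lemma ninv_descent w i :
  (w^-1)%g (pos_hi i) < (w^-1)%g (pos_lo i) ->
  ninv w = (ninv (w * simple_refl i)%g).+1.
Proof.
move=> desc; rewrite -{1}(simple_reflK w i) ninv_ascent //.
by rewrite !permV_mul_tperm tpermL tpermR.
Qed.

Lemma ascent_or_descent w i :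
  (w^-1)%g (pos_lo i) < (w^-1)%g (pos_hi i) \/
  (w^-1)%g (pos_hi i) < (w^-1)%g (pos_lo i).
Proof.
have [| |/val_inj/perm_inj/eqP] := ltngtP ((w^-1)%g (pos_lo i)); auto.
by rewrite lo_neq_hi.
Qed.

Lemma ninv_le_size c : ninv (word_perm c) <= size c.
Proof.
elim/last_ind: c => [|c i IHc].
  rewrite leqn0 cards_eq0 -finset.subset0; apply/fintype.subsetP => -[p q]; rewrite !inE /=.
  by rewrite /word_perm big_nil invg1 !perm1; case: ltngtP.
rewrite word_perm_rcons size_rcons.
have [/ninv_ascent ->|/ninv_descent desc] :=
  ascent_or_descent (word_perm c) i; first by rewrite ltnS.
by apply: leq_trans (leq_trans IHc _); rewrite ?leqnSn // desc leqnSn.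
Qed.

Lemma mono_perm_ge w : (forall a b, a < b -> w a < w b) -> forall a : 'I_n, a <= w a.
Proof.
move=> mono [m]; elim: m => [//|m IHm] lt_m.
have lt_m' := ltnW lt_m.
by apply: leq_ltn_trans (IHm lt_m') (mono _ _ _); rewrite /=.
Qed.

Lemma mono_perm_eq1 w : (forall a b, a < b -> w a < w b) -> w = 1%g.
Proof.
move=> mono.
have monoV a b : a < b -> (w^-1)%g a < (w^-1)%g b.
  move=> lt_ab; have [//|/mono|/val_inj/perm_inj eq_ab] := ltngtP ((w^-1)%g a).
    by rewrite !permKV; lia.
  by rewrite eq_ab ltnn in lt_ab.
apply/permP => a; rewrite perm1; apply/val_inj/eqP.
by rewrite eqn_leq (mono_perm_ge mono) andbT -{2}(permK w a) mono_perm_ge.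
Qed.

Lemma ascents_eq1 w :
  (forall i, (w^-1)%g (pos_lo i) < (w^-1)%g (pos_hi i)) -> w = 1%g.
Proof.
move=> asc; apply: invg_inj; rewrite invg1; apply: mono_perm_eq1 => a [b].
elim: b => [//|b IHb] lt_b /=; rewrite ltnS => le_ab.
have lt_b1 : b < n.-1 by rewrite ltn_predRL.
have lt_b' := ltnW lt_b.
have := asc (Ordinal lt_b1).
have -> : pos_hi (Ordinal lt_b1) = Ordinal lt_b by apply: val_inj.
have -> : pos_lo (Ordinal lt_b1) = Ordinal lt_b' by apply: val_inj.
move: le_ab; rewrite leq_eqVlt => /orP[/eqP eq_ab|lt_ab].
  by have -> : a = Ordinal lt_b' by apply: val_inj.
by apply: ltn_trans; apply: IHb.
Qed.

(** Sorting by removing adjacent descents uses one letter for each inversion. *)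
Lemma word_of_ninv_letters w :
  exists2 c, word_perm c = w & size c = ninv w.
Proof.
have [m le_m] := ubnP (ninv w); elim: m => // m IHm in w le_m *.
case: (pickP (fun i => (w^-1)%g (pos_hi i) < (w^-1)%g (pos_lo i))) => [i desc|asc].
  have inv_w := ninv_descent desc.
  have [|c c_w c_size] := IHm (w * simple_refl i)%g; first by rewrite -ltnS -inv_w.
  exists (rcons c i); first by rewrite word_perm_rcons c_w simple_reflK.
  by rewrite size_rcons c_size.
have -> : w = 1%g.
  by apply: ascents_eq1 => i; case: (ascent_or_descent w i); rewrite ?asc.
exists [::]; first by rewrite /word_perm big_nil.
by have := ninv_le_size [::]; rewrite /word_perm big_nil leqn0 => /eqP->.
Qed.

Lemma cox_lengthE w : cox_length w = ninv w.
Proof.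
rewrite /cox_length; case: ex_minnP => m /existsP[t /eqP t_w] m_min.
have := ninv_le_size t; rewrite t_w size_tuple => le_m.
apply/eqP; rewrite eqn_leq le_m andbT.
have [c c_w <-] := word_of_ninv_letters w.
by apply: m_min; apply/existsP; exists (in_tuple c); rewrite c_w.
Qed.

Definition reduced c := size c == ninv (word_perm c).

Lemma reduced_wordE c w : reduced_word c w -> word_perm c = w /\ reduced c.
Proof.
by case/andP => /eqP w_c; rewrite cox_lengthE /reduced w_c.
Qed.

Lemma reduced_rcons c i : reduced (rcons c i) ->
  reduced c /\ ((word_perm c)^-1)%g (pos_lo i) < ((word_perm c)^-1)%g (pos_hi i).
Proof.
rewrite /reduced word_perm_rcons size_rcons => /eqP sz.
have le_c := ninv_le_size c.
have [asc|/ninv_descent desc] := ascent_or_descent (word_perm c) i.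
  by rewrite ninv_ascent // in sz; split=> //; apply/eqP; lia.
by lia.
Qed.

(** Induction on the distance of the positions: (a b+1) is the conjugate of
    (a b) by the simple reflection at b. The two simple reflections cannot both
    lower the length, because if the value at b exceeds the one at b+1, it also
    exceeds the one at a. *)
Lemma ninv_tperm_lt w a b : a < b -> (w^-1)%g a < (w^-1)%g b ->
  ninv w < ninv (w * tperm a b)%g.
Proof.
case: b => b; elim: b w => [//|b IHb] w lt_b /=; rewrite ltnS => le_ab.
have lt_b1 : b < n.-1 by rewrite ltn_predRL.
have lt_b' := ltnW lt_b.
pose i := Ordinal lt_b1.
have hi_i : pos_hi i = Ordinal lt_b by apply: val_inj.
have lo_i : pos_lo i = Ordinal lt_b' by apply: val_inj.
rewrite -hi_i; move: le_ab; rewrite leq_eqVlt => /orP[/eqP eq_ab|lt_ab] lt_w.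
  have eq_a : a = pos_lo i by apply: val_inj.
  by move: lt_w; rewrite eq_a -/(simple_refl i) => /ninv_ascent->.
have a_lo : a != pos_lo i by rewrite -val_eqE /=; lia.
have a_hi : a != pos_hi i by rewrite -val_eqE /=; lia.
pose w1 : 'S_n := (w * simple_refl i)%g; pose w2 : 'S_n := (w1 * tperm a (pos_lo i))%g.
have w12 : ninv w1 < ninv w2.
  rewrite /w2 lo_i; apply: IHb => //.
  by rewrite !permV_mul_tperm -lo_i tpermL tpermD 1?eq_sym.
have -> : (w * tperm a (pos_hi i) = w2 * simple_refl i)%g.
  rewrite /w2 /w1 -!mulgA; congr (_ * _)%g.
  have {1}-> : simple_refl i = ((simple_refl i)^-1)%g by rewrite tpermV.
  by rewrite -conjgE tpermJ tpermL tpermD 1?eq_sym.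
have w2E x : (w2^-1)%g x = (w^-1)%g (simple_refl i (tperm a (pos_lo i) x)).
  by rewrite !permV_mul_tperm.
have w2lo : (w2^-1)%g (pos_lo i) = (w^-1)%g a.
  by rewrite w2E tpermR /simple_refl tpermD 1?eq_sym.
have w2hi : (w2^-1)%g (pos_hi i) = (w^-1)%g (pos_lo i).
  by rewrite w2E [tperm _ _ _]tpermD ?lo_neq_hi // [simple_refl i _]tpermR.
have [/ninv_ascent asc|desc] := ascent_or_descent w i.
  have [/ninv_ascent|/ninv_descent] := ascent_or_descent w2 i;
    rewrite -/w1 in asc; lia.
have := ninv_descent desc.
rewrite (@ninv_ascent w2 i) ?w2lo ?w2hi; last by lia.
by rewrite -/w1; lia.
Qed.

(** If the values at a < k < b increase, the transposition (a b) is the product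
    (a k) (k b) (a k), each factor of which raises the length, by at least 3 in
    total. *)
Lemma cover_no_between w a b (k : 'I_n) :
  ninv (w * tperm a b)%g = (ninv w).+1 ->
  a < k < b -> (w^-1)%g a < (w^-1)%g k < (w^-1)%g b -> False.
Proof.
move=> cov /andP[ak kb] /andP[wak wkb].
have Dab : a != b by rewrite -val_eqE /=; lia.
have Dak : a != k by rewrite -val_eqE /=; lia.
have Dkb : k != b by rewrite -val_eqE /=; lia.
have e : (w * tperm a b = w * tperm a k * tperm k b * tperm a k)%g.
  have eV : tperm a k = ((tperm a k)^-1)%g by rewrite tpermV.
  rewrite -!mulgA; congr (_ * _)%g.
  by rewrite {1}eV -conjgE tpermJ tpermR tpermD // eq_sym.
have h1 := ninv_tperm_lt ak wak.
have h2 : ninv (w * tperm a k)%g < ninv (w * tperm a k * tperm k b)%g.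
  by apply: ninv_tperm_lt; rewrite // !permV_mul_tperm tpermR tpermD //; lia.
have h3 : ninv (w * tperm a k * tperm k b)%g
        < ninv (w * tperm a k * tperm k b * tperm a k)%g.
  apply: ninv_tperm_lt; rewrite // !permV_mul_tperm tpermL.
  rewrite (tpermD (z := a)) ?tpermL 1?[b == a]eq_sym 1?[k == a]eq_sym ?(tpermD (z := b)) //.
move: h3; rewrite -e cov; lia.
Qed.

(** These are the ranks of the lower left submatrices of [perm_mx w] with the
    columns up to i, which detect the Bruhat order. *)
Definition rank_count w (i : 'I_n.-1) (m : nat) : nat :=
  \sum_(k : 'I_n | k <= i) (m <= (w^-1)%g k).

Lemma rank_count_tperm w a b i m : a <= i < b -> (w^-1)%g a < (w^-1)%g b ->
  rank_count (w * tperm a b)%g i m =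
    rank_count w i m + ((w^-1)%g a < m <= (w^-1)%g b).
Proof.
case/andP=> le_ai lt_ib lt_w.
rewrite /rank_count (bigD1 a) //= [in RHS](bigD1 a) //= permV_mul_tperm tpermL.
rewrite (eq_bigr (fun k => nat_of_bool (m <= (w^-1)%g k))).
  by rewrite addnAC; congr (_ + _); lia.
move=> k /andP[le_k neq_k]; rewrite permV_mul_tperm tpermD //.
  by rewrite eq_sym.
by rewrite -val_eqE /=; lia.
Qed.

Lemma rank_count_tperm_id w a b i m : a < b -> ~~ (a <= i < b) ->
  rank_count (w * tperm a b)%g i m = rank_count w i m.
Proof.
move=> lt_ab; rewrite negb_and -!ltnNge ltnS => out.
rewrite /rank_count [RHS](reindex_inj (@perm_inj _ (tperm a b))) /=.
apply: eq_big => k; last by rewrite permV_mul_tperm.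
by case: tpermP => [->|->|//]; lia.
Qed.

Lemma rank_count_simple w i m :
  (w^-1)%g (pos_lo i) < (w^-1)%g (pos_hi i) ->
  rank_count (w * simple_refl i)%g i m =
    rank_count w i m + ((w^-1)%g (pos_lo i) < m <= (w^-1)%g (pos_hi i)).
Proof. by move=> asc; rewrite rank_count_tperm //= leqnn ltnSn. Qed.

Definition dominated w w' (i : 'I_n.-1) : Prop :=
  forall m, rank_count w i m <= rank_count w' i m.

Lemma ascent_not_dominated w i :
  (w^-1)%g (pos_lo i) < (w^-1)%g (pos_hi i) ->
  ~ dominated (w * simple_refl i)%g w i.
Proof.
move=> asc /(_ ((w^-1)%g (pos_hi i))).
by rewrite rank_count_simple // asc leqnn addn1 ltnn.
Qed.

(** Multiplying by (a b) raises the rank counts on the values in the interval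
    from [(w^-1) a] to [(w^-1) b], provided that the columns up to i separate a
    from b. Domination therefore nests the interval of the simple reflection in
    that of (a b), and a position strictly between a and b would contradict
    [cover_no_between]. *)
Lemma cover_dominated w a b i : a < b -> (w^-1)%g a < (w^-1)%g b ->
  ninv (w * tperm a b)%g = (ninv w).+1 ->
  (w^-1)%g (pos_lo i) < (w^-1)%g (pos_hi i) ->
  dominated (w * simple_refl i)%g (w * tperm a b)%g i ->
  a = pos_lo i /\ b = pos_hi i.
Proof.
move=> lt_ab lt_w cov asc dom.
have [|out] := boolP (a <= i < b); last first.
  by case: (ascent_not_dominated asc) => m; rewrite (leq_trans (dom m)) ?rank_count_tperm_id.
move=> /[dup] mid /andP[le_ai lt_ib].
have lo_a : (w^-1)%g a <= (w^-1)%g (pos_lo i).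
  by have := dom ((w^-1)%g (pos_lo i)).+1; rewrite rank_count_simple // rank_count_tperm //; lia.
have hi_b : (w^-1)%g (pos_hi i) <= (w^-1)%g b.
  by have := dom ((w^-1)%g (pos_hi i)); rewrite rank_count_simple // rank_count_tperm //; lia.
have neq_w p q : p != q -> (w^-1)%g p != (w^-1)%g q :> nat.
  by apply: contra => /eqP/val_inj/perm_inj ->.
split; apply/eqP/idPn => neq; have := neq_w _ _ neq; move: neq;
  rewrite -val_eqE /= => neq neq'; apply: (@cover_no_between w a b _ cov).
- by instantiate (1 := pos_lo i); rewrite /=; lia.
- by lia.
- by instantiate (1 := pos_hi i); rewrite /=; lia.
- by lia.
Qed.

(** Deleting the letter k multiplies by a reflection, the conjugate of
    [simple_refl k] by the letters that follow it. If domination held, this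
    reflection would be [simple_refl i], and then appending i to the longer word
    would shorten it. *)
Lemma deletion_not_dominated c k c' i :
  reduced (rcons (c ++ k :: c') i) -> reduced (rcons (c ++ c') i) ->
  ~ dominated (word_perm (rcons (c ++ c') i)) (word_perm (c ++ k :: c')) i.
Proof.
move=> /reduced_rcons[red1 asc1] /reduced_rcons[red asc].
rewrite word_perm_rcons; set w := word_perm (c ++ c') in red asc *.
pose z := word_perm c'.
have w1E : word_perm (c ++ k :: c') = (w * tperm (z (pos_lo k)) (z (pos_hi k)))%g.
  rewrite /w -cat1s !word_perm_cat -/z {2}/word_perm big_seq1 -tpermJ conjgE.
  by rewrite -!mulgA mulKVg.
have [a [b [lt_ab {}w1E]]] :
    exists a, exists b, a < b /\ word_perm (c ++ k :: c') = (w * tperm a b)%g.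
  have [lt|lt|/val_inj/perm_inj/eqP] := ltngtP (z (pos_lo k)) (z (pos_hi k)).
  - by exists (z (pos_lo k)), (z (pos_hi k)).
  - by exists (z (pos_hi k)), (z (pos_lo k)); rewrite tpermC.
  - by rewrite lo_neq_hi.
have cov : ninv (w * tperm a b)%g = (ninv w).+1.
  rewrite -w1E -(eqP red1) -(eqP red) !size_cat /=; lia.
have lt_w : (w^-1)%g a < (w^-1)%g b.
  have [//|lt|/val_inj/perm_inj e] := ltngtP ((w^-1)%g a) ((w^-1)%g b).
    have := @ninv_tperm_lt (w * tperm a b)%g a b lt_ab.
    rewrite !permV_mul_tperm tpermL tpermR -mulgA tperm2 mulg1 => /(_ lt); lia.
  by rewrite e ltnn in lt_ab.
rewrite w1E => /(cover_dominated lt_ab lt_w cov asc)[ea eb].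
by move: asc1; rewrite w1E ea eb !permV_mul_tperm tpermL tpermR; lia.
Qed.

Lemma deletes_at_most_one_not_dominated (c c' : seq 'I_n.-1) i :
  deletes_at_most_one c c' -> reduced (rcons c' i) -> reduced (rcons c i) ->
  ~ dominated (word_perm (rcons c i)) (word_perm c') i.
Proof.
move=> [->|[p [k [q [-> ->]]]]] red' red; last exact: deletion_not_dominated.
by rewrite word_perm_rcons; apply: ascent_not_dominated; case: (reduced_rcons red).
Qed.

End Inversions.

(** * Bruhat cells of invertible matrices *)

Section Cells.

Local Open Scope ring_scope.

Variables (K : fieldType) (n : nat).
Implicit Types (w : 'S_n) (i : 'I_n.-1) (b c g x y : 'M[K]_n).

Definition upper b : Prop :=
  (forall k l : 'I_n, (l < k)%N -> b k l = 0) /\ b \in unitmx.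

Lemma det_upper b : (forall k l : 'I_n, (l < k)%N -> b k l = 0) ->
  \det b = \prod_k b k k.
Proof.
move=> b0; rewrite -det_tr det_trig.
  by apply: eq_bigr => k _; rewrite mxE.
by apply/is_trig_mxP => k l lt_kl; rewrite mxE b0.
Qed.

Lemma upper_diag_neq0 b k : upper b -> b k k != 0.
Proof.
case=> /det_upper b_det; rewrite unitmxE b_det unitfE.
by move/prodf_neq0 => /(_ k isT).
Qed.

Lemma upper_diag b : (forall k l : 'I_n, (l < k)%N -> b k l = 0) ->
  (forall k, b k k != 0) -> upper b.
Proof.
move=> b0 bd; split=> //; rewrite unitmxE det_upper // unitfE.
by apply/prodf_neq0 => k _.
Qed.

Lemma upperM b c : upper b -> upper c -> upper (b *m c).
Proof.
move=> [b0 bU] [c0 cU]; split; last by rewrite unitmx_mul bU.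
move=> k l lt_lk; rewrite mxE big1 // => j _.
have [lt_jk|le_kj] := ltnP j k; first by rewrite b0 ?mul0r.
by rewrite c0 ?mulr0 // (leq_trans lt_lk).
Qed.

Lemma upper1 : upper 1%:M.
Proof.
apply: upper_diag => [k l lt_lk|k]; rewrite mxE ?eqxx ?oner_eq0 //.
by rewrite -val_eqE gtn_eqF.
Qed.

(** Row k of [b *m invmx b = 1] determines row k of the inverse from the rows
    below it. *)
Lemma upper_inv b : upper b -> upper (invmx b).
Proof.
move=> ub; have [b0 bU] := ub; split; last by rewrite unitmx_inv.
move=> k l; have [m le_m] := ubnP (n - k).
elim: m => // m IHm in k le_m * => lt_lk.
have : (b *m invmx b) k l = 0 by rewrite mulmxV // mxE -val_eqE gtn_eqF.
rewrite mxE (bigD1 k) //= big1 ?addr0 => [/eqP|j neq_jk].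
  by rewrite mulf_eq0 (negPf (upper_diag_neq0 k ub)) => /eqP.
have [lt_jk|lt_kj|/val_inj eq_jk] := ltngtP j k.
- by rewrite b0 ?mul0r.
- by rewrite IHm ?mulr0 //; have := ltn_ord j; lia.
- by rewrite eq_jk eqxx in neq_jk.
Qed.

Definition elem (p q : 'I_n) (t : K) : 'M[K]_n := 1%:M + t *: delta_mx p q.

Lemma perm_mul_mxE w x k l : (perm_mx w *m x) k l = x (w k) l.
Proof. by rewrite -row_permE mxE. Qed.

Lemma mul_perm_mxE w x k l : (x *m perm_mx w) k l = x k ((w^-1)%g l).
Proof. by rewrite -{1}(invgK w) -col_permE mxE. Qed.

Lemma elem_mulE p q t x k l : (elem p q t *m x) k l = x k l + t * (k == p)%:R * x q l.
Proof.
rewrite mulmxDl mul1mx -scalemxAl !mxE -mulrA; congr (_ + _ * _).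
rewrite (bigD1 q) //= mxE eqxx andbT big1 ?addr0 // => j neq_j.
by rewrite mxE (negPf neq_j) andbF mul0r.
Qed.

Lemma mul_elemE p q t x k l : (x *m elem p q t) k l = x k l + t * (l == q)%:R * x k p.
Proof.
rewrite mulmxDr mulmx1 -scalemxAr !mxE -mulrA; congr (_ + _ * _).
rewrite (bigD1 p) //= mxE eqxx /= big1 ?addr0 1?mulrC // => j neq_j.
by rewrite mxE (negPf neq_j) mulr0.
Qed.

Lemma elemM p q t t' : p != q -> elem p q t *m elem p q t' = elem p q (t + t').
Proof.
move=> neq_pq; apply/matrixP => k l; rewrite elem_mulE !mxE.
rewrite [q == p]eq_sym (negPf neq_pq) [q == l]eq_sym.
by case: (k == p); case: (l == q) => /=; ring.
Qed.

Lemma elem0 p q : elem p q 0 = 1%:M.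
Proof. by rewrite /elem scale0r addr0. Qed.

Lemma elemK p q t : p != q -> elem p q t *m elem p q (- t) = 1%:M.
Proof. by move=> neq_pq; rewrite elemM // subrr elem0. Qed.

Lemma elem_unit p q t : p != q -> elem p q t \in unitmx.
Proof. by move=> neq_pq; case: (mulmx1_unit (elemK t neq_pq)). Qed.

Lemma elem_upper (p q : 'I_n) t : (p < q)%N -> upper (elem p q t).
Proof.
move=> lt_pq; split=> [k l lt_lk|]; last by rewrite elem_unit // -val_eqE neq_ltn lt_pq.
rewrite !mxE -!val_eqE /=.
have -> : (k == l :> nat) = false by lia.
have -> : (k == p :> nat) && (l == q :> nat) = false by lia.
by rewrite mulr0 addr0.
Qed.

Lemma det_elem p q t : p != q -> \det (elem p q t) = 1.
Proof.
wlog lt_pq : p q / (p < q)%N => [hw|] neq_pq.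
  have [lt|lt|/val_inj eq_pq] := ltngtP p q; first exact: hw.
    rewrite -det_tr [X in \det X](_ : _ = elem q p t); first by rewrite hw // eq_sym.
    by rewrite /elem !linearD /= linearZ /= trmx1 trmx_delta.
  by rewrite eq_pq eqxx in neq_pq.
rewrite det_upper; last by case: (elem_upper t lt_pq).
rewrite big1 // => k _; rewrite !mxE eqxx.
by case: eqP => [->|_]; rewrite ?(negPf neq_pq) mulr0 addr0.
Qed.

Lemma perm_mul_elem w p q t :
  perm_mx w *m elem p q t = elem ((w^-1)%g p) ((w^-1)%g q) t *m perm_mx w.
Proof.
apply/matrixP => k l; rewrite perm_mul_mxE mul_perm_mxE !mxE.
by rewrite (inj_eq perm_inj) !(canF_eq (permK w)).
Qed.

(** The Bruhat cell in GL_n: dropping the determinants allows [perm_mx w] as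
    representative of [w], whatever its sign. *)
Definition cell w g : Prop :=
  exists b c, [/\ upper b, upper c & g = b *m perm_mx w *m c].

Lemma cell_mul_upper w g c : cell w g -> upper c -> cell w (g *m c).
Proof.
move=> [b [c' [ub uc' ->]]] uc; exists b, (c' *m c).
by split=> //; [apply: upperM | rewrite !mulmxA].
Qed.

(** With invertibility this describes the parabolic subgroup generated by B
    and [simple_refl i]. *)
Definition in_minimal_parabolic i x : Prop :=
  forall k l : 'I_n, (l < k)%N -> (k, l) != (pos_hi i, pos_lo i) -> x k l = 0.

Lemma in_minimal_parabolicM i b x :
  upper b -> in_minimal_parabolic i x -> in_minimal_parabolic i (b *m x).
Proof.
move=> [b0 _] px k l lt_lk neq; rewrite mxE big1 // => j _.
have [lt_jk|le_kj] := ltnP j k; first by rewrite b0 ?mul0r.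
rewrite px ?mulr0 //; first exact: leq_trans lt_lk le_kj.
by move: neq; rewrite !xpair_eqE -!val_eqE /=; lia.
Qed.

(** The part outside B of the minimal parabolic subgroup is
    U_i s_i B, with U_i the root subgroup of the entry (i, i+1). The ascent
    means that conjugation by [w] sends U_i into B. *)
Lemma cell_mul_ascent w i y x :
  ((w^-1)%g (pos_lo i) < (w^-1)%g (pos_hi i))%N ->
  cell w y -> in_minimal_parabolic i x -> x \in unitmx ->
  x (pos_hi i) (pos_lo i) != 0 -> cell (w * simple_refl i)%g (y *m x).
Proof.
move=> asc [b [b' [ub ub' ->]]] px xU x_neq0.
set lo := pos_lo i; set hi := pos_hi i.
have lo_hi : lo != hi by rewrite lo_neq_hi.
pose q := b' *m x.
have pq : in_minimal_parabolic i q by apply: in_minimal_parabolicM.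
have qU : q \in unitmx by rewrite unitmx_mul xU andbT; case: ub'.
have q_neq0 : q hi lo != 0.
  rewrite /q mxE (bigD1 hi) //= big1 ?addr0 ?mulf_neq0 ?upper_diag_neq0 //.
  move=> j neq_j; have [lt_j|le_j] := ltnP j hi.
    by case: ub' => b0 _; rewrite b0 ?mul0r.
  by rewrite px ?mulr0 // ?xpair_eqE /lo ?(negPf neq_j) //; move: le_j; rewrite /=; lia.
(* z clears the entry (lo, lo), so that exchanging the two rows leaves an upper
   triangular matrix. *)
pose z := q lo lo / q hi lo.
pose c := perm_mx (simple_refl i) *m (elem lo hi (- z) *m q).
have uc : upper c.
  split; last by rewrite unitmx_mul unitmx_perm unitmx_mul elem_unit.
  move=> k l lt_lk; rewrite perm_mul_mxE elem_mulE /simple_refl -/lo -/hi.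
  case: tpermP => [k_lo|k_hi|/eqP k_lo /eqP k_hi].
  - rewrite [hi == lo]eq_sym (negPf lo_hi) mulr0 mul0r addr0 pq //.
      by move: lt_lk; rewrite k_lo /=; lia.
    by rewrite xpair_eqE negb_and -!val_eqE /=; move: lt_lk; rewrite k_lo /=; lia.
  - rewrite eqxx mulr1; have [->|neq_l] := eqVneq l lo.
      by rewrite mulNr /z divfK // subrr.
    have lt_l : (l < lo)%N.
      by move: lt_lk neq_l; rewrite k_hi -val_eqE /=; lia.
    have -> : q lo l = 0 by rewrite pq // xpair_eqE (negPf lo_hi).
    have -> : q hi l = 0.
      by rewrite pq ?xpair_eqE ?(negPf neq_l) ?andbF //=; move: lt_l; rewrite /=; lia.
    by rewrite mulr0 addr0.
  - rewrite (negPf k_lo) mulr0 mul0r addr0 pq //.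
    by rewrite xpair_eqE (negPf k_hi).
have qE : q = elem lo hi z *m (perm_mx (simple_refl i) *m c).
  rewrite /c [perm_mx _ *m (perm_mx _ *m _)]mulmxA -perm_mxM tperm2 perm_mx1 mul1mx.
  by rewrite mulmxA elemK // mul1mx.
clearbody c; exists (b *m elem ((w^-1)%g lo) ((w^-1)%g hi) z), c; split=> //.
  by apply: upperM => //; apply: elem_upper.
rewrite -!mulmxA [b' *m x]qE perm_mxM !mulmxA; congr (_ *m _ *m _).
by rewrite -!mulmxA perm_mul_elem.
Qed.

(** Write x = b w s_i b'. If the entry (i, i+1) of b' is nonzero, a column
    operation brings s_i b' back into B; if it is zero, s_i b' s_i is already
    in B. *)
Lemma cell_peel w i x : cell (w * simple_refl i)%g x ->
  (exists2 t, t != 0 & cell w (x *m elem (pos_hi i) (pos_lo i) (- t))) \/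
  cell w (x *m perm_mx (simple_refl i)).
Proof.
move=> [b [b' [ub [b0 b'U] ->]]].
set lo := pos_lo i; set hi := pos_hi i.
have lo_hi : hi != lo by rewrite eq_sym lo_neq_hi.
have ub' : upper b' by split.
have [c0|c_neq0] := eqVneq (b' lo hi) 0; [right|left].
  exists b, (perm_mx (simple_refl i) *m b' *m perm_mx (simple_refl i)).
  split=> //; last by rewrite perm_mxM !mulmxA.
  split; last by rewrite !unitmx_mul !unitmx_perm b'U.
  move=> k l lt_lk; rewrite mul_perm_mxE perm_mul_mxE tpermV.
  have [e|neq] := eqVneq (l, k) (lo, hi).
    by case/eqP: e; rewrite xpair_eqE => /andP[/eqP-> /eqP->]; rewrite tpermL tpermR.
  by rewrite b0 // simple_refl_lt.
exists (b' lo lo / b' lo hi); first by rewrite mulf_neq0 ?invr_eq0 ?upper_diag_neq0.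
set t := _ / _; exists b, (perm_mx (simple_refl i) *m (b' *m elem hi lo (- t))).
split=> //; last by rewrite perm_mxM !mulmxA.
split; last by rewrite !unitmx_mul unitmx_perm b'U elem_unit.
move=> k l lt_lk; rewrite perm_mul_mxE mul_elemE /simple_refl -/lo -/hi.
case: tpermP => [k_lo|k_hi|/eqP k_lo /eqP k_hi].
- have lt_l : (l < lo)%N by rewrite -k_lo.
  have /negPf-> : l != lo by rewrite -val_eqE neq_ltn lt_l.
  by rewrite mulr0 mul0r addr0 b0 //=; move: lt_l; rewrite /=; lia.
- have [->|neq_l] := eqVneq l lo.
    by rewrite mulr1 mulNr /t divfK // subrr.
  rewrite mulr0 mul0r addr0 b0 //.
  by move: lt_lk neq_l; rewrite k_hi -val_eqE /=; lia.
- rewrite b0 // add0r; have [eq_l|neq_l] := eqVneq l lo; last by rewrite mulr0 mul0r.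
  rewrite b0 ?mulr0 //; move: lt_lk k_hi; rewrite eq_l -val_eqE /=; lia.
Qed.

End Cells.

(** * Minors in the first columns *)

Section Minors.

Local Open Scope ring_scope.

Variables (K : fieldType) (n : nat).
Implicit Types (w : 'S_n) (i : 'I_n.-1) (b c g x y : 'M[K]_n).

(** Completing the leading block by columns of the identity keeps all
    matrices of size n, and does not change its determinant. *)
Definition lead_block i x : 'M[K]_n :=
  \matrix_(k, l) if (l <= i)%N then x k l else (k == l)%:R.

Definition lead_minor i x : K := \det (lead_block i x).

(** Right multiplication by an upper triangular matrix acts on the first columns
    by its own leading block. *)
Lemma lead_minorM i x c : upper c ->
  lead_minor i (x *m c) = lead_minor i x * lead_minor i c.
Proof.
move=> [c0 _]; rewrite /lead_minor -det_mulmx; congr (\det _).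
apply/matrixP => k l; rewrite !mxE; have [le_l|lt_l] := leqP l i.
  apply: eq_bigr => j _; rewrite !mxE le_l.
  have [//|lt_j] := leqP j i.
  by rewrite c0 ?mulr0 //; lia.
rewrite (bigD1 l) //= !mxE leqNgt lt_l /= eqxx mulr1 big1 ?addr0 // => j neq_j.
by rewrite !mxE [(l <= i)%N]leqNgt lt_l /= (negPf neq_j) mulr0.
Qed.

Lemma lead_minor_upper_neq0 i c : upper c -> lead_minor i c != 0.
Proof.
move=> uc; have c0 := uc.1; rewrite /lead_minor det_upper => [|k l lt_lk].
  apply/prodf_neq0 => k _; rewrite mxE eqxx.
  by case: ifP; rewrite ?oner_eq0 // upper_diag_neq0.
by rewrite mxE c0 // -val_eqE gtn_eqF //; case: ifP.
Qed.

(** Up to sign, the minor of the columns up to i and of the rows [(w^-1) k] for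
    k up to i. *)
Definition flag_minor w i x : K := lead_minor i (perm_mx w^-1 *m x).

Lemma flag_minorM w i b c w' : upper c ->
  flag_minor w i (b *m perm_mx w' *m c) =
    flag_minor w i (b *m perm_mx w') * lead_minor i c.
Proof. by move=> uc; rewrite /flag_minor mulmxA lead_minorM. Qed.

(** For y = b w c, conjugation by [w] turns the minor into a principal minor of
    b. *)
Lemma flag_minor_cell_neq0 w i y : cell w y -> flag_minor w i y != 0.
Proof.
move=> [b [c [ub uc ->]]]; rewrite flag_minorM //.
apply: mulf_neq0; last exact: lead_minor_upper_neq0.
pose T : 'M[K]_n := \matrix_(k, l) if (w l <= i)%N then b k l else (k == l)%:R.
have -> : flag_minor w i (b *m perm_mx w) = \det T.
  have <- : \det (perm_mx w^-1 *m T *m perm_mx w) = \det T.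
    by rewrite !det_mulmx mulrAC -det_mulmx -perm_mxM mulVg perm_mx1 det1 mul1r.
  congr (\det _); apply/matrixP => k l; rewrite mul_perm_mxE perm_mul_mxE [LHS]mxE [RHS]mxE.
  by rewrite perm_mul_mxE mul_perm_mxE permKV (inj_eq perm_inj).
have b0 := ub.1; rewrite det_upper => [|k l lt_lk].
  apply/prodf_neq0 => k _; rewrite mxE eqxx.
  by case: ifP; rewrite ?oner_eq0 // upper_diag_neq0.
by rewrite mxE b0 // -val_eqE gtn_eqF //; case: ifP.
Qed.

(** A nonzero term of the Leibniz expansion is a permutation t of the first
    positions with [(w^-1) k <= (w'^-1) (t k)], because b is upper
    triangular. *)
Lemma flag_minor_dominated w w' i y :
  cell w' y -> flag_minor w i y != 0 -> dominated w w' i.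
Proof.
move=> [b [c [[b0 _] uc ->]]]; rewrite flag_minorM // mulf_eq0 negb_or => /andP[+ _] m.
rewrite /flag_minor /lead_minor; set M := lead_block i _ => detM.
have [t tP] : exists t : 'S_n, forall k, M k (t k) != 0.
  case: (pickP (fun t : 'S_n => [forall k, M k (t k) != 0])) => [t /forallP|noT].
    by exists t.
  case/eqP: detM; rewrite /determinant big1 // => t _.
  have /negbT := noT t; rewrite negb_forall => /existsP[k]; rewrite negbK => /eqP Mk.
  by rewrite (bigD1 k) //= Mk mul0r mulr0.
have t_out (l : 'I_n) : (i < l)%N -> t l = l.
  move=> lt_l; apply/(canLR (permKV t))/eqP; have := tP ((t^-1)%g l).
  rewrite permKV mxE leqNgt lt_l /=.
  by rewrite [l == _]eq_sym; apply: contraR => /negPf->; rewrite eqxx.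
have t_in (k : 'I_n) : (k <= i)%N -> (t k <= i)%N.
  move=> le_k; rewrite leqNgt; apply/negP => lt_tk.
  by have /perm_inj e := t_out _ lt_tk; rewrite e ltnNge le_k in lt_tk.
have t_inE (k : 'I_n) : (t k <= i)%N = (k <= i)%N.
  apply/idP/idP; last exact: t_in.
  by rewrite leqNgt => le_tk; rewrite leqNgt; apply: contra le_tk => /[dup] /t_out ->.
rewrite /rank_count [leqRHS](reindex_inj (@perm_inj _ t)) /=.
rewrite [leqRHS](eq_bigl (fun k : 'I_n => k <= i)%N) //.
apply: leq_sum => k le_k; have := tP k; rewrite mxE t_in //.
rewrite perm_mul_mxE mul_perm_mxE => neq0.
have le_rows : ((w^-1)%g k <= (w'^-1)%g (t k))%N.
  by rewrite leqNgt; apply: contra neq0 => /b0 ->.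
by lia.
Qed.

Lemma flag_minor_eq0 w w' i y :
  ~ dominated w w' i -> cell w' y -> flag_minor w i y = 0.
Proof.
move=> ndom cy; apply/eqP/idPn => neq0.
exact: ndom (flag_minor_dominated cy neq0).
Qed.

(** The coefficient of -t in [flag_minor_elem]. *)
Definition flag_minor_swap w i x : K := flag_minor w i (x *m perm_mx (simple_refl i)).

Lemma lead_minor_linear i x y (z : 'M[K]_n) (t : K) :
  (forall k l : 'I_n, (l < i)%N -> y k l = x k l /\ z k l = x k l) ->
  (forall k, x k (pos_lo i) = y k (pos_lo i) + t * z k (pos_lo i)) ->
  lead_minor i x = lead_minor i y + t * lead_minor i z.
Proof.
move=> same lin; rewrite /lead_minor -!(det_tr (lead_block _ _)) -[X in X + _]mul1r.
have lift_same (l : 'I_n.-1) k : (lift (pos_lo i) l <= i)%N ->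
    y k (lift (pos_lo i) l) = x k (lift (pos_lo i) l) /\
    z k (lift (pos_lo i) l) = x k (lift (pos_lo i) l).
  move=> le_l; apply: same; rewrite ltn_neqAle le_l andbT.
  by have := neq_lift (pos_lo i) l; rewrite -val_eqE eq_sym.
apply: (@determinant_multilinear _ _ _ _ _ (pos_lo i)).
- by apply/rowP => k; rewrite !mxE leqnn lin mul1r.
- by apply/matrixP => l k; rewrite !mxE; case: ifP => // /lift_same -/(_ k)[].
- by apply/matrixP => l k; rewrite !mxE; case: ifP => // /lift_same -/(_ k)[].
Qed.

Lemma flag_minor_elem w i x t :
  flag_minor w i (x *m elem (pos_hi i) (pos_lo i) (- t)) =
    flag_minor w i x - t * flag_minor_swap w i x.
Proof.
rewrite /flag_minor_swap /flag_minor !mulmxA -mulNr; apply: lead_minor_linear => k.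
  move=> l lt_l; rewrite mul_elemE mul_perm_mxE tpermV tpermD.
  - by have /negPf-> : l != pos_lo i; rewrite ?mulr0 ?mul0r ?addr0 // -val_eqE neq_ltn lt_l.
  - by rewrite -val_eqE gtn_eqF.
  - by rewrite -val_eqE gtn_eqF //= ltnS ltnW.
by rewrite mul_elemE mul_perm_mxE tpermV tpermL eqxx mulr1.
Qed.

(** The minor vanishes on the cell of w'. By [cell_peel] that cell contains
    either a point with finite parameter, which is then the root of an affine
    function of t, or the point at infinity, excluded by the nonzero
    denominator. *)
Lemma cell_peel_minor w w' i x :
  ~ dominated w w' i -> cell (w' * simple_refl i)%g x -> flag_minor_swap w i x != 0 ->
  flag_minor w i x / flag_minor_swap w i x != 0 /\
  cell w' (x *m elem (pos_hi i) (pos_lo i) (- (flag_minor w i x / flag_minor_swap w i x))).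
Proof.
move=> ndom cx D0; have [[t t0 ct]|cs] := cell_peel cx; last first.
  by rewrite /flag_minor_swap (flag_minor_eq0 ndom cs) eqxx in D0.
have /eqP := flag_minor_eq0 ndom ct; rewrite flag_minor_elem subr_eq0 => /eqP->.
by rewrite mulfK.
Qed.

(** The minor of [u] vanishes at g, which is in a smaller cell, and not at g';
    [flag_minor_elem] relates the two values. *)
Lemma flag_minor_ratio w i g t :
  ((w^-1)%g (pos_lo i) < (w^-1)%g (pos_hi i))%N -> cell w g ->
  cell (w * simple_refl i)%g (g *m elem (pos_hi i) (pos_lo i) t) ->
  let g' := g *m elem (pos_hi i) (pos_lo i) t in
  let u := (w * simple_refl i)%g in
  flag_minor_swap u i g' != 0 /\ flag_minor u i g' / flag_minor_swap u i g' = t.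
Proof.
move=> asc cg cg' g' u.
have neq := flag_minor_cell_neq0 i cg'.
have := flag_minor_eq0 (ascent_not_dominated asc) cg.
have -> : g = g' *m elem (pos_hi i) (pos_lo i) (- t).
  by rewrite /g' -mulmxA elemK ?mulmx1 // eq_sym lo_neq_hi.
rewrite flag_minor_elem => /eqP; rewrite subr_eq0 => /eqP N_tD.
have D0 : flag_minor_swap u i g' != 0.
  by apply: contraNneq neq => D0; rewrite -/g' -/u N_tD D0 mulr0.
by rewrite N_tD mulfK.
Qed.

Lemma simple_in_minimal_parabolic i : in_minimal_parabolic i (perm_mx (simple_refl i) : 'M[K]_n).
Proof.
move=> k l lt_lk neq; rewrite !mxE; case: eqP => // kl; exfalso.
move: kl lt_lk neq; rewrite /simple_refl; case: tpermP => [->|->|_ _] <-.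
- by rewrite /= ltnNge leqnSn.
- by rewrite eqxx.
- by rewrite ltnn.
Qed.

Lemma elem_in_minimal_parabolic i t :
  in_minimal_parabolic i (elem (pos_hi i) (pos_lo i) t : 'M[K]_n).
Proof.
move=> k l lt_lk; rewrite xpair_eqE => /negPf neq; rewrite !mxE neq mulr0 addr0.
by rewrite -val_eqE gtn_eqF.
Qed.

(** The denominator is the minor of [u] at g s_i, which is in the cell of
    [u]. *)
Lemma flag_minor_extension w i g :
  ((w^-1)%g (pos_lo i) < (w^-1)%g (pos_hi i))%N -> cell w g ->
  let u := (w * simple_refl i)%g in
  flag_minor_swap u i g != 0 /\ flag_minor u i g = 0.
Proof.
move=> asc cg u; split; last exact: flag_minor_eq0 (ascent_not_dominated asc) cg.
apply: flag_minor_cell_neq0; apply: cell_mul_ascent => //.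
- exact: simple_in_minimal_parabolic.
- exact: unitmx_perm.
- by rewrite !mxE tpermR eqxx oner_eq0.
Qed.

Lemma cell_mul_elem w i g t : t != 0 ->
  ((w^-1)%g (pos_lo i) < (w^-1)%g (pos_hi i))%N -> cell w g ->
  cell (w * simple_refl i)%g (g *m elem (pos_hi i) (pos_lo i) t).
Proof.
have hi_lo : pos_hi i != pos_lo i by rewrite eq_sym lo_neq_hi.
move=> t0 asc cg; apply: cell_mul_ascent => //.
- exact: elem_in_minimal_parabolic.
- exact: elem_unit.
- by rewrite !mxE (negPf hi_lo) !eqxx mulr1 add0r.
Qed.

(** An automorphism of GL_n that fixes the permutation matrices and exchanges
    upper and lower triangular matrices; it transfers statements on B to
    B^-. *)
Definition contragredient x : 'M[K]_n := (invmx x)^T.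

Lemma contragredient_unique x y : x *m y = 1%:M -> contragredient x = y^T.
Proof.
move=> xy; have [xU _] := mulmx1_unit xy.
by rewrite /contragredient -[in RHS](mulKmx xU y) xy mulmx1.
Qed.

Lemma contragredientM x y : x \in unitmx -> y \in unitmx ->
  contragredient (x *m y) = contragredient x *m contragredient y.
Proof.
move=> xU yU; rewrite (@contragredient_unique _ (invmx y *m invmx x)).
  by rewrite trmx_mul.
by rewrite mulmxA mulmxK // mulmxV.
Qed.

Lemma contragredient_adj x : \det x = 1 -> contragredient x = (\adj x)^T.
Proof.
by move=> x1; apply: contragredient_unique; rewrite mul_mx_adj x1.
Qed.

Lemma contragredient_elem p q t : p != q ->
  contragredient (elem p q t) = elem q p (- t) :> 'M[K]_n.
Proof.
move=> neq_pq; rewrite (contragredient_unique (elemK t neq_pq)).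
by rewrite /elem !linearD /= linearZ /= trmx1 trmx_delta.
Qed.

Lemma contragredient_upper b : upper b^T -> upper (contragredient b).
Proof.
by move=> ub; rewrite /contragredient trmx_inv; apply: upper_inv.
Qed.

Lemma SL_unit x : \det x = 1 -> x \in unitmx.
Proof. by move=> x1; rewrite unitmxE x1 unitr1. Qed.

Lemma Bplus_upper b : Bplus b -> upper b.
Proof.
move=> [b1 /is_trig_mxP b0]; split; last exact: SL_unit.
by move=> k l /b0; rewrite mxE.
Qed.

Lemma Bminus_lower b : Bminus b -> upper b^T.
Proof.
move=> [b1 /is_trig_mxP b0]; split; last by rewrite unitmx_tr SL_unit.
by move=> k l /b0; rewrite mxE.
Qed.

Lemma diag_upper (d : 'rV[K]_n) : diag_mx d \in unitmx -> upper (diag_mx d).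
Proof.
by move=> dU; split=> // k l lt_lk; rewrite mxE -val_eqE gtn_eqF.
Qed.

Lemma bruhat_cell_plus w g : bruhat_cell (@Bplus K n) w g -> \det g = 1 /\ cell w g.
Proof.
move=> [b [c [wd [bB cB [wd1 [d wdE]] ->]]]]; split.
  by rewrite !det_mulmx bB.1 cB.1 wd1 !mulr1.
have := SL_unit wd1; rewrite wdE unitmx_mul => /andP[dU _].
exists (b *m diag_mx d), c; split; last by rewrite !mulmxA.
  by apply: upperM; [apply: Bplus_upper | apply: diag_upper].
exact: Bplus_upper.
Qed.

Lemma bruhat_cell_minus w g :
  bruhat_cell (@Bminus K n) w g -> cell w (contragredient g).
Proof.
move=> [b [c [wd [bB cB [wd1 [d wdE]] ->]]]].
have wdU := SL_unit wd1; have bU := SL_unit bB.1; have cU := SL_unit cB.1.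
move: (wdU); rewrite wdE unitmx_mul => /andP[dU _].
rewrite !contragredientM ?unitmx_mul ?bU ?dU ?unitmx_perm //.
rewrite [contragredient (perm_mx w)](@contragredient_unique _ (perm_mx w^-1)); last first.
  by rewrite -perm_mxM mulgV perm_mx1.
rewrite tr_perm_mx invgK.
exists (contragredient b *m contragredient (diag_mx d)), (contragredient c).
split; last by rewrite !mulmxA.
  apply: upperM; apply: contragredient_upper; first exact: Bminus_lower.
  by rewrite tr_diag_mx; apply: diag_upper.
by apply: contragredient_upper; apply: Bminus_lower.
Qed.

End Minors.

(** * Polynomial functions on matrices *)

Section Polynomials.

Local Open Scope ring_scope.

Variables (K : fieldType) (n : nat).
Implicit Types (x : 'M[K]_n) (F G : 'M[K]_n -> K) (w : 'S_n) (i : 'I_n.-1).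

Definition polyfun F : Prop :=
  exists p : {mpoly K[n * n]}, forall x, F x = p.@[fun k => mxvec x 0 k].

Lemma polyfun_const (t : K) : polyfun (fun=> t).
Proof. by exists t%:MP => x; rewrite mevalC. Qed.

Lemma polyfun_entry k l : polyfun (fun x => x k l).
Proof. by exists 'X_(mxvec_index k l) => x; rewrite mevalXU mxvecE. Qed.

Lemma polyfunD F G : polyfun F -> polyfun G -> polyfun (fun x => F x + G x).
Proof. by move=> [p pE] [q qE]; exists (p + q) => x; rewrite mevalD pE qE. Qed.

Lemma polyfunM F G : polyfun F -> polyfun G -> polyfun (fun x => F x * G x).
Proof. by move=> [p pE] [q qE]; exists (p * q) => x; rewrite mevalM pE qE. Qed.

Lemma polyfun_eq F G : F =1 G -> polyfun F -> polyfun G.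
Proof. by move=> FG [p pE]; exists p => x; rewrite -FG. Qed.

Lemma polyfun_sum (I : Type) (r : seq I) (F : I -> 'M[K]_n -> K) :
  (forall j, polyfun (F j)) -> polyfun (fun x => \sum_(j <- r) F j x).
Proof.
move=> pF; elim: r => [|j r IHr].
  by apply: polyfun_eq (polyfun_const 0) => x; rewrite big_nil.
by apply: polyfun_eq (polyfunD (pF j) IHr) => x; rewrite big_cons.
Qed.

Lemma polyfun_prod (I : Type) (r : seq I) (F : I -> 'M[K]_n -> K) :
  (forall j, polyfun (F j)) -> polyfun (fun x => \prod_(j <- r) F j x).
Proof.
move=> pF; elim: r => [|j r IHr].
  by apply: polyfun_eq (polyfun_const 1) => x; rewrite big_nil.
by apply: polyfun_eq (polyfunM (pF j) IHr) => x; rewrite big_cons.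
Qed.

Lemma polyfunX F m : polyfun F -> polyfun (fun x => F x ^+ m).
Proof.
move=> pF; apply: polyfun_eq (polyfun_prod (iota 0 m) (fun=> pF)) => x.
by rewrite big_const_seq count_predT size_iota iter_mulr_1.
Qed.

Definition polymap (P : 'M[K]_n -> 'M[K]_n) : Prop :=
  forall k l, polyfun (fun x => P x k l).

Lemma polyfun_comp F P : polyfun F -> polymap P -> polyfun (F \o P).
Proof.
move=> [p pE] pP.
apply: (@polyfun_eq (fun x => \sum_(m <- msupp p)
    p@_m * \prod_(j <- enum 'I_(n * n)) mxvec (P x) 0 j ^+ m j)).
  by move=> x; rewrite /= pE mevalE; apply: eq_bigr => m _; rewrite big_enum.
apply: polyfun_sum => m; apply: polyfunM; first exact: polyfun_const.
apply: polyfun_prod => j; apply: polyfunX.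
case/mxvec_indexP: j => k l.
by apply: polyfun_eq (pP k l) => x; rewrite mxvecE.
Qed.

Lemma polyfun_det m (A : 'M[K]_n -> 'M[K]_m) :
  (forall k l, polyfun (fun x => A x k l)) -> polyfun (fun x => \det (A x)).
Proof.
move=> pA.
apply: (@polyfun_eq (fun x => \sum_(s <- index_enum {perm 'I_m})
    ((-1) ^+ s * \prod_(k <- index_enum 'I_m) A x k (s k)))) => //.
apply: polyfun_sum => s; apply: polyfunM; first exact: polyfun_const.
by apply: polyfun_prod => k; apply: pA.
Qed.

Lemma polymap_mul P Q : polymap P -> polymap Q -> polymap (fun x => P x *m Q x).
Proof.
move=> pP pQ k l.
apply: (@polyfun_eq (fun x => \sum_(j <- index_enum 'I_n) P x k j * Q x j l)).
  by move=> x; rewrite mxE.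
by apply: polyfun_sum => j; apply: polyfunM.
Qed.

Lemma polymap_const (A : 'M[K]_n) : polymap (fun=> A).
Proof. by move=> k l; apply: polyfun_const. Qed.

Lemma polymap_id : polymap id.
Proof. exact: polyfun_entry. Qed.

Lemma polymapD P Q : polymap P -> polymap Q -> polymap (fun x => P x + Q x).
Proof.
move=> pP pQ k l; apply: polyfun_eq (polyfunD (pP k l) (pQ k l)) => x.
by rewrite mxE.
Qed.

Lemma polymapZ F P : polyfun F -> polymap P -> polymap (fun x => F x *: P x).
Proof.
by move=> pF pP k l; apply: polyfun_eq (polyfunM pF (pP k l)) => x; rewrite mxE.
Qed.

(** Homogeneity lets a polynomial be evaluated at a matrix with rational entries:
    multiplying the matrix by the common denominator only multiplies the value
    by a nonzero factor. *)
Definition homogeneous d F : Prop := forall t x, F (t *: x) = t ^+ d * F x.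

Lemma polyfun_flag_minor w i : polyfun (flag_minor w i).
Proof.
apply: polyfun_det => k l; have [le_l|lt_l] := boolP (l <= i)%N.
  apply: polyfun_eq (polymap_mul (polymap_const _) polymap_id k l) => x.
  by rewrite [RHS]mxE le_l.
apply: polyfun_eq (polyfun_const (k == l)%:R) => x.
by rewrite mxE (negPf lt_l).
Qed.

Lemma polyfun_flag_minor_swap w i : polyfun (flag_minor_swap w i).
Proof.
apply: (polyfun_comp (polyfun_flag_minor w i)).
exact: polymap_mul polymap_id (polymap_const _).
Qed.

Definition lead_degree i := #|[pred l : 'I_n | (l <= i)%N]|.

Lemma homogeneous_flag_minor w i : homogeneous (lead_degree i) (flag_minor w i).
Proof.
move=> t x; rewrite /flag_minor -scalemxAr; move: (_ *m x) => y.
pose d : 'rV[K]_n := \row_l if (l <= i)%N then t else 1.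
have -> : lead_minor i (t *: y) = \det (lead_block i y *m diag_mx d).
  congr (\det _); apply/matrixP => k l; rewrite mul_mx_diag !mxE.
  by case: ifP => _; rewrite ?mulr1 // mulrC.
rewrite det_mulmx det_diag mulrC; congr (_ * _).
rewrite (eq_bigr (fun l : 'I_n => if (l <= i)%N then t else 1)).
  by rewrite -big_mkcond /= prodr_const.
by move=> l _; rewrite mxE.
Qed.

Lemma homogeneous_flag_minor_swap w i : homogeneous (lead_degree i) (flag_minor_swap w i).
Proof.
by move=> t x; rewrite /flag_minor_swap -scalemxAl homogeneous_flag_minor.
Qed.

(** A polynomial map that agrees with [contragredient] on SL_n. *)
Definition adj_tr x := (\adj x)^T.

Lemma polymap_adj_tr : polymap adj_tr.
Proof.
move=> k l; apply: (@polyfun_eq (fun x => cofactor x k l)).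
  by move=> x; rewrite !mxE.
apply: polyfunM; first exact: polyfun_const.
apply: polyfun_det => j h.
by apply: polyfun_eq (polyfun_entry (lift k j) (lift l h)) => x; rewrite !mxE.
Qed.

Lemma homogeneous_adj_tr d F :
  homogeneous d F -> homogeneous (n.-1 * d) (F \o adj_tr).
Proof.
by move=> hF t x; rewrite /= /adj_tr adjZ linearZ /= hF exprM.
Qed.

End Polynomials.

(** * Neighbourhoods contained in a factorization torus *)

Section TorusNeighbourhoods.

Local Open Scope ring_scope.

Variables (K : fieldType) (n : nat).
Implicit Types (x g : 'M[K]_n) (F : 'M[K]_n -> K) (i : 'I_n.-1).
Implicit Types (a : letter n) (s : seq (letter n)).

(** As [contragredient] exchanges B with B^- and fixes the permutation matrices,
    the last condition is membership in a Bruhat cell for B^-. *)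
Definition in_cells s x : Prop :=
  [/\ \det x = 1, cell (word_perm (barred s)) x
    & cell (word_perm (unbarred s)) (contragredient x)].

(** On some Zariski neighbourhood of [g], the double cell of [s] is contained in
    the torus of [s]; [g] itself may lie outside the double cell. *)
Definition torus_near s g : Prop :=
  exists d F, [/\ polyfun F, homogeneous d F, F g != 0
    & forall x, in_cells s x -> F x != 0 -> factor_torus s x].

Lemma factor_torus_nil x : factor_torus [::] x <-> torusH x.
Proof.
split=> [[h [t [hH /size0nil-> _ ->]]]|xH]; first by rewrite /= big_nil mulmx1.
by exists x, [::]; split=> //; rewrite big_nil mulmx1.
Qed.

Lemma big_mulmx_rcons (I : Type) (r : seq I) j (A : I -> 'M[K]_n) :
  \big[mulmx/1%:M]_(k <- rcons r j) A k = (\big[mulmx/1%:M]_(k <- r) A k) *m A j.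
Proof.
elim: r => [|k r IHr] /=; first by rewrite big_cons !big_nil mul1mx mulmx1.
by rewrite !big_cons IHr mulmxA.
Qed.

Lemma factor_torus_rcons s a x : factor_torus (rcons s a) x <->
  exists g t, [/\ factor_torus s g, t != 0 & x = g *m letter_mx a t].
Proof.
split=> [[h [t [hH st t0 ->]]]|[g [t [[h [ts [hH st t0 ->]]] t_neq0 ->]]]].
  case/lastP: t => [|t z] in st t0 *; first by rewrite size_rcons in st.
  rewrite !size_rcons in st; case: st => st.
  move: t0; rewrite all_rcons => /andP[z0 t0].
  exists (h *m \big[mulmx/1%:M]_(b <- zip s t) letter_mx b.1 b.2), z.
  split=> //; first by exists h, t.
  by rewrite zip_rcons // big_mulmx_rcons mulmxA.
exists h, (rcons ts t); split=> //; first by rewrite !size_rcons st.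
  by rewrite all_rcons t_neq0.
by rewrite zip_rcons // big_mulmx_rcons mulmxA.
Qed.

Definition letter_unit a : 'M[K]_n :=
  match a with
  | inl i => delta_mx (pos_hi i) (pos_lo i)
  | inr i => delta_mx (pos_lo i) (pos_hi i)
  end.

Lemma letter_mxE a t : letter_mx a t = 1%:M + t *: letter_unit a.
Proof. by case: a. Qed.

Lemma letter_mxK x a t : x *m letter_mx a t *m letter_mx a (- t) = x.
Proof.
rewrite -mulmxA; case: a => i /=.
  by rewrite [X in _ *m X](elemK t) ?mulmx1 // eq_sym lo_neq_hi.
by rewrite [X in _ *m X](elemK t) ?mulmx1 // lo_neq_hi.
Qed.

Lemma det_letter_mx a t : \det (letter_mx a t : 'M[K]_n) = 1.
Proof. by case: a => i; apply: det_elem; rewrite ?lo_neq_hi // eq_sym lo_neq_hi. Qed.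

Lemma contragredient_mul_letter x a t : \det x = 1 ->
  contragredient (x *m letter_mx a t) = contragredient x *m
    match a with
    | inl i => elem (pos_lo i) (pos_hi i) (- t)
    | inr i => elem (pos_hi i) (pos_lo i) (- t) end.
Proof.
move=> x1; rewrite contragredientM ?SL_unit ?det_letter_mx //; congr (_ *m _).
by case: a => i; apply: contragredient_elem; rewrite ?lo_neq_hi // eq_sym lo_neq_hi.
Qed.

Lemma barred_rcons s a :
  barred (rcons s a) = if a is inl i then rcons (barred s) i else barred s.
Proof. by rewrite /barred -!cats1 pmap_cat; case: a => i //=; rewrite ?cats1 ?cats0. Qed.

Lemma unbarred_rcons s a :
  unbarred (rcons s a) = if a is inr i then rcons (unbarred s) i else unbarred s.
Proof. by rewrite /unbarred -!cats1 pmap_cat; case: a => i //=; rewrite ?cats1 ?cats0. Qed.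

(** Pulling the neighbourhood of the shortened element back along the map that
    removes the letter. *)
Lemma torus_near_rcons s a g d (N D : 'M[K]_n -> K) :
  polyfun N -> homogeneous d N -> polyfun D -> homogeneous d D -> D g != 0 ->
  (forall x, in_cells (rcons s a) x -> D x != 0 ->
     N x / D x != 0 /\ in_cells s (x *m letter_mx a (- (N x / D x)))) ->
  torus_near s (g *m letter_mx a (- (N g / D g))) ->
  torus_near (rcons s a) g.
Proof.
move=> pN hN pD hD Dg peel [e [F [pF hF Fg Fcell]]].
(* P x is the shortened element multiplied by the denominator D x. *)
pose P x := D x *: x + (- N x) *: (x *m letter_unit a).
have PE x : D x != 0 -> P x = D x *: (x *m letter_mx a (- (N x / D x))).
  move=> Dx; rewrite letter_mxE mulmxDr mulmx1 -scalemxAr scalerDr scalerA.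
  by rewrite mulrN mulrCA divff ?mulr1.
have pP : polymap P.
  apply: polymapD; apply: polymapZ => //; first exact: polymap_id.
    by apply: polyfun_eq (polyfunM (polyfun_const _ (-1)) pN) => x; rewrite mulN1r.
  exact: polymap_mul (@polymap_id _ _) (polymap_const _).
have hP t x : P (t *: x) = t ^+ d.+1 *: P x.
  rewrite /P hD hN -scalemxAl !scalerA scalerDr !scalerA exprSr.
  by congr (_ *: _ + _ *: _); ring.
exists (d + d.+1 * e)%N, (fun x => D x * F (P x)); split.
- by apply: polyfunM => //; apply: (polyfun_comp pF pP).
- by move=> t x; rewrite hP hF hD -exprM exprD; ring.
- by rewrite mulf_neq0 // PE // hF mulf_neq0 // expf_neq0.
move=> x cx; rewrite mulf_eq0 negb_or => /andP[Dx]; rewrite PE // hF.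
rewrite mulf_eq0 negb_or => /andP[_ Fx].
have [t0 cy] := peel x cx Dx.
apply/factor_torus_rcons; set y := x *m _ in cy Fx.
exists y, (N x / D x); split=> //; first exact: Fcell.
by rewrite /y -{2}[N x / D x]opprK letter_mxK.
Qed.

Lemma torus_near_barred s i w g :
  ~ dominated w (word_perm (barred s)) i -> flag_minor_swap w i g != 0 ->
  torus_near s (g *m letter_mx (inl i) (- (flag_minor w i g / flag_minor_swap w i g))) ->
  torus_near (rcons s (inl i)) g.
Proof.
move=> ndom Dg; apply: torus_near_rcons Dg _;
  [exact: polyfun_flag_minor|exact: homogeneous_flag_minor|
   exact: polyfun_flag_minor_swap|exact: homogeneous_flag_minor_swap|].
move=> x [x1]; rewrite barred_rcons unbarred_rcons word_perm_rcons => cx cx' Dx.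
have [t0 cy] := cell_peel_minor ndom cx Dx; split=> //; split=> //.
  by rewrite det_mulmx det_letter_mx x1 mulr1.
rewrite contragredient_mul_letter // opprK; apply: cell_mul_upper => //.
exact: elem_upper (lo_lt_hi i).
Qed.

(** The barred case transported by [contragredient]. Since this map changes the
    sign of the parameter of a letter, the numerator carries a sign. *)
Lemma torus_near_unbarred s i w g :
  let g' := contragredient g in \det g = 1 ->
  ~ dominated w (word_perm (unbarred s)) i -> flag_minor_swap w i g' != 0 ->
  torus_near s (g *m letter_mx (inr i) (flag_minor w i g' / flag_minor_swap w i g')) ->
  torus_near (rcons s (inr i)) g.
Proof.
move=> g' g1 ndom Dg near.
pose N x : K := (-1) * (flag_minor w i \o @adj_tr K n) x.
pose D := flag_minor_swap w i \o @adj_tr K n.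
have NE x : \det x = 1 -> N x = - flag_minor w i (contragredient x).
  by move=> x1; rewrite contragredient_adj // /N mulN1r.
have DE x : \det x = 1 -> D x = flag_minor_swap w i (contragredient x).
  by move=> x1; rewrite contragredient_adj.
have ratioE x : \det x = 1 -> - (N x / D x) =
    flag_minor w i (contragredient x) / flag_minor_swap w i (contragredient x).
  by move=> x1; rewrite NE // DE // mulNr opprK.
have pmap := @polymap_adj_tr K n.
apply: (@torus_near_rcons s (inr i) g (n.-1 * lead_degree i) N D).
- exact: (polyfunM (polyfun_const _ (-1)) (polyfun_comp (polyfun_flag_minor K w i) pmap)).
- move=> t x; rewrite /N (homogeneous_adj_tr (@homogeneous_flag_minor K n w i)).
  by rewrite mulrCA.
- exact: (polyfun_comp (polyfun_flag_minor_swap K w i) pmap).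
- by apply: homogeneous_adj_tr; apply: homogeneous_flag_minor_swap.
- by rewrite DE.
- move=> x [x1]; rewrite barred_rcons unbarred_rcons word_perm_rcons => cx cx'.
  move=> Dx; rewrite DE // in Dx; rewrite -oppr_eq0 ratioE //.
  have [t0 cy] := cell_peel_minor ndom cx' Dx; split=> //; split=> //.
  + by rewrite det_mulmx det_letter_mx x1 mulr1.
  + by apply: cell_mul_upper => //; apply: elem_upper (lo_lt_hi i).
  + by rewrite contragredient_mul_letter.
- by rewrite ratioE.
Qed.

Lemma torusH_in_cells x : torusH x -> in_cells [::] x.
Proof.
move=> [xB xB']; split; first exact: xB.1.
  rewrite /word_perm big_nil; exists x, 1%:M.
  by split; [exact: Bplus_upper|exact: upper1|rewrite perm_mx1 !mulmx1].
rewrite /word_perm big_nil; exists (contragredient x), 1%:M.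
split; [|exact: upper1|by rewrite perm_mx1 !mulmx1].
by apply: contragredient_upper; apply: Bminus_lower.
Qed.

Lemma in_cells_torusH x : in_cells [::] x -> torusH x.
Proof.
have upper_cell1 y : cell (word_perm (@nil 'I_n.-1)) y -> upper y.
  rewrite /word_perm big_nil => -[b [c [ub uc ->]]].
  by rewrite perm_mx1 mulmx1; apply: upperM.
move=> [x1 /upper_cell1 ux /upper_cell1 ux'].
have lx : upper x^T.
  suff -> : x^T = invmx (contragredient x) by apply: upper_inv.
  by rewrite /contragredient -trmx_inv invmxK.
split; split=> //; apply/is_trig_mxP => k l lt; first by rewrite mxE ux.1.
by have := lx.1 l k lt; rewrite mxE.
Qed.

Definition double_reduced_word s := reduced (barred s) && reduced (unbarred s).

Lemma double_reduced_word_rcons s a :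
  double_reduced_word (rcons s a) -> double_reduced_word s.
Proof.
rewrite /double_reduced_word barred_rcons unbarred_rcons.
by case: a => i /andP[]; [move=> /reduced_rcons[-> _]|move=> -> /reduced_rcons[]].
Qed.

(** In a reduced word every letter is an ascent for one factor of
    the double cell ([cell_mul_elem]), and it is triangular for the other. *)
Lemma factor_torus_cells s x :
  double_reduced_word s -> factor_torus s x -> in_cells s x.
Proof.
elim/last_ind: s x => [|s a IHs] x red.
  by move/factor_torus_nil; apply: torusH_in_cells.
case/factor_torus_rcons => g [t [gs t0 ->]].
have [g1 cg cg'] := IHs g (double_reduced_word_rcons red) gs.
split; first by rewrite det_mulmx g1 det_letter_mx mulr1.
  move: red; rewrite /double_reduced_word barred_rcons; case: a => i /andP[red _].
    rewrite word_perm_rcons; apply: cell_mul_elem => //.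
    by case: (reduced_rcons red).
  by apply: cell_mul_upper => //; apply: elem_upper (lo_lt_hi i).
rewrite contragredient_mul_letter //.
move: red; rewrite /double_reduced_word unbarred_rcons; case: a => i /andP[_ red].
  by apply: cell_mul_upper => //; apply: elem_upper (lo_lt_hi i).
rewrite word_perm_rcons; apply: cell_mul_elem => //; first by rewrite oppr_eq0.
by case: (reduced_rcons red).
Qed.


(** Induction on s': either its last letter is the deleted one, and g stays
    the same with parameter 0 for that letter, or it is the last letter of s
    too, and g loses this letter with its own parameter. *)
Lemma factor_torus_near s s' g :
  deletes_at_most_one s s' -> double_reduced_word s -> double_reduced_word s' ->
  factor_torus s g -> torus_near s' g.
Proof.
elim/last_ind: s' s g => [|s' a IHs] s g.
  move=> _ _ _ _; exists 0, (fun=> 1); split; last by move=> x /in_cells_torusH /factor_torus_nil.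
  - exact: polyfun_const.
  - by move=> t x; rewrite mulr1.
  - exact: oner_neq0.
move=> del red red'; have red1' := double_reduced_word_rcons red'.
have [->|[s1 [eq_s {}del]]] :
    s = s' \/ exists s1, s = rcons s1 a /\ deletes_at_most_one s1 s'.
  case: del => [->|[p [b [q [e ->]]]]]; first by right; exists s'; split=> //; left.
  case/lastP: q e => [|q z]; first by rewrite cats0 cats1 => /rcons_inj[-> _]; left.
  rewrite -rcons_cons -!rcons_cat => /rcons_inj[-> ->].
  by right; exists (p ++ q); split=> //; right; exists p, b, q.
- move=> {del} gs; have near := IHs s' g (or_introl erefl) red1' red1' gs.
  have [g1 cg cg'] := factor_torus_cells red1' gs.
  move: red'; rewrite /double_reduced_word barred_rcons unbarred_rcons.
  case: a => i /andP[].
    move=> /reduced_rcons[_ asc] _.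
    have [D0 N0] := flag_minor_extension asc cg.
    apply: (torus_near_barred _ D0); first exact: ascent_not_dominated.
    by rewrite N0 mul0r oppr0 letter_mxE scale0r addr0 mulmx1.
  move=> _ /reduced_rcons[_ asc].
  have [D0 N0] := flag_minor_extension asc cg'.
  apply: (torus_near_unbarred g1 _ D0); first exact: ascent_not_dominated.
  by rewrite N0 mul0r letter_mxE scale0r addr0 mulmx1.
rewrite {}eq_s in red *; move=> /[dup] gs /factor_torus_rcons[g1 [t [g1s _ gE]]].
have red1 := double_reduced_word_rcons red.
have near := IHs s1 g1 del red1 red1' g1s.
have [det_g1 c1 c1'] := factor_torus_cells red1 g1s.
have [det_g cg cg'] := factor_torus_cells red gs.
move: cg cg' red red'; rewrite /double_reduced_word !barred_rcons !unbarred_rcons.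
case: a gE {gs} => i gE cg cg' /andP[red redu] /andP[red' redu'].
  have [_ asc] := reduced_rcons red.
  rewrite gE word_perm_rcons in cg.
  have [D0 ratio] := flag_minor_ratio asc c1 cg.
  apply: (@torus_near_barred _ _ (word_perm (barred s1) * simple_refl i)%g).
  - rewrite -word_perm_rcons; apply: deletes_at_most_one_not_dominated => //.
    exact: deletes_at_most_one_pmap.
  - by rewrite gE.
  - by rewrite gE ratio letter_mxK.
have [_ asc] := reduced_rcons redu.
rewrite gE contragredient_mul_letter // word_perm_rcons in cg'.
have [D0 ratio] := flag_minor_ratio asc c1' cg'.
apply: (@torus_near_unbarred _ _ (word_perm (unbarred s1) * simple_refl i)%g) => //.
- rewrite -word_perm_rcons; apply: deletes_at_most_one_not_dominated => //.
  exact: deletes_at_most_one_pmap.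
- by rewrite gE contragredient_mul_letter.
- by rewrite gE contragredient_mul_letter // ratio letter_mxK.
Qed.

Lemma double_reduced_wordE (p : 'S_n * 'S_n) s : double_reduced p s ->
  [/\ word_perm (barred s) = p.1, word_perm (unbarred s) = p.2 & double_reduced_word s].
Proof.
by move=> /andP[/reduced_wordE[-> r1] /reduced_wordE[-> r2]]; split=> //; apply/andP.
Qed.

Lemma double_cell_in_cells (p : 'S_n * 'S_n) s x :
  double_reduced p s -> double_cell K p x -> in_cells s x.
Proof.
move=> /double_reduced_wordE[e1 e2 _] [/bruhat_cell_plus[x1 cx] /bruhat_cell_minus cx'].
by split; rewrite ?e1 ?e2.
Qed.

(** The polynomial of [factor_torus_near] separates g from the deep locus of
    q. *)
Theorem closure_deep_locus (p q : 'S_n * 'S_n) :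
  (double_cell K p `&` SL_closure (deep_locus K q) `<=` ext_deep_locus K p q)%classic.
Proof.
move=> g [gp [_ g_closed]]; split=> // -[s [ps [s' qs' [k lt_k sE]]] gs].
have [_ _ red] := double_reduced_wordE ps.
have [_ _ red'] := double_reduced_wordE qs'.
have del : deletes_at_most_one s s'.
  right; case: s' lt_k sE {qs' red'} => // a0 s' lt_k ->.
  exists (take k (a0 :: s')), (nth a0 (a0 :: s') k), (drop k.+1 (a0 :: s')).
  by rewrite -drop_nth // cat_take_drop.
have [d [F [[f fE] _ /eqP Fg near]]] := factor_torus_near del red red' gs.
apply: Fg; rewrite fE; apply: g_closed => x [xq x_deep].
rewrite -fE; apply/eqP/idPn => Fx; apply: x_deep; exists s' => //.
by apply: near Fx; apply: double_cell_in_cells xq.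
Qed.

End TorusNeighbourhoods.

Local Open Scope classical_set_scope.

Theorem proposition1p8 (R : realType) (n : nat) (u v u' v' : 'S_n) :
  bruhat2_lt (u, v) (u', v') ->
  cox_length2 (u', v') = (cox_length2 (u, v)).+1 ->
  double_cell R[i] (u, v) `&` SL_closure (deep_locus R[i] (u', v'))
    `<=` ext_deep_locus R[i] (u, v) (u', v').
Proof. by move=> _ _; apply: closure_deep_locus. Qed.
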